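(* Let $A\in\mathbb{R}_{\geq 0}^{M\times N}$ and $Y\in\mathbb{R}_{\geq 0}^{M\times T}$, and let $\lambda_B,\mu_B,\lambda_C,\mu_C,\tau\geq 0$. For $B\in\mathbb{R}_{\geq 0}^{N\times K}$, $C\in\mathbb{R}_{\geq 0}^{K\times T}$ define the cost function $$\mathcal{F}(B,C)=\frac12\Vert ABC-Y\Vert_F^2+\lambda_C\Vert C\Vert_1+\frac{\mu_C}{2}\Vert C\Vert_F^2+\lambda_B\Vert B\Vert_1+\frac{\mu_B}{2}\Vert B\Vert_F^2+\frac{\tau}{2}\operatorname{TV}(B).$$ Then, for any initialisations $B^{[0]}\in\mathbb{R}_{>0}^{N\times K}$, $C^{[0]}\in\mathbb{R}_{>0}^{K\times T}$, the alternating update rules (for $d=0,1,2,\dots$) $$B^{[d+1]}=B^{[d]}\circ\frac{A^\intercal Y{C^{[d]}}^\intercal+\tau P(B^{[d]})\circ Z(B^{[d]})}{A^\intercal AB^{[d]}C^{[d]}{C^{[d]}}^\intercal+\mu_BB^{[d]}+\lambda_B\mathbf{1}_{N\times K}+\tau B^{[d]}\circ P(B^{[d]})},$$ $$C^{[d+1]}=C^{[d]}\circ\frac{{B^{[d+1]}}^\intercal A^\intercal Y}{{B^{[d+1]}}^\intercal A^\intercal AB^{[d+1]}C^{[d]}+\mu_CC^{[d]}+\lambda_C\mathbf{1}_{K\times T}}$$ lead to a monotonic decrease of the cost function, i.e. $\mathcal{F}(B^{[d+1]},C^{[d+1]})\leq\mathcal{F}(B^{[d]},C^{[d]})$ for all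 $d\geq 0$.
   Context: $M,N,T,K$ are positive integers. $\Vert\cdot\Vert_F$ is the Frobenius norm, $\Vert M\Vert_1=\sum_{ij}|M_{ij}|$. The symbol $\circ$ denotes the entrywise (Hadamard) product and the fractions of matrices are entrywise quotients; $\mathbf{1}_{M\times N}$ is the $M\times N$ matrix with all entries $1$. The strictly positive initialisation is imposed so that the divisions in the update rules are well defined. Smoothed isotropic total variation: the row indices $n\in\{1,\dots,N\}$ of $B$ represent pixels. For every $n$ a set $\mathcal{N}_n\subset\{1,\dots,N\}$ of indices of spatially neighbouring pixels is fixed (for instance, in two dimensions the neighbours $(1,0)$ and $(0,1)$ for the pixel $(0,0)$), and $\varepsilon_{\mathrm{TV}}>0$ is a fixed constant. For $B\in\mathbb{R}^{N\times K}$, $$\operatorname{TV}(B)=\sum_{k=1}^K\sum_{n=1}^N|\nabla_{nk}B|,\qquad |\nabla_{nk}B|=\sqrt{\varepsilon_{\mathrm{TV}}^2+\sum_{\ell\in\mathcal{N}_n}(B_{nk}-B_{\ell k})^2}.$$ The adjoint neighbourhood $\bar{\mathcal{N}}_n$ is defined by $\ell\in\bar{\mathcal{N}}_n\Leftrightarrow n\in\mathcal{N}_\ell$. The matrices $P(B),Z(B)\in\mathbb{R}_{\geq0}^{N\times K}$ are $$P(B)_{nk}=\frac{1}{|\nabla_{nk}B|}\sum_{\ell\in\mathcal{N}_n}1+\sum_{\ell\in\bar{\mathcal{N}}_n}\frac{1}{|\nabla_{\ell k}B|},$$ $$Z(B)_{nk}=\frac{1}{P(B)_{nk}}\left(\frac{1}{|\nabla_{nk}B|}\sum_{\ell\in\mathcal{N}_n}\frac{B_{nk}+B_{\ell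 k}}{2}+\sum_{\ell\in\bar{\mathcal{N}}_n}\frac{B_{nk}+B_{\ell k}}{2|\nabla_{\ell k}B|}\right).$$ *)

(* Defs.v *)
From HB Require Import structures.
From mathcomp Require Export all_boot all_order all_algebra.
From mathcomp Require Export reals.

Set Implicit Arguments.
Unset Strict Implicit.
Unset Printing Implicit Defensive.

Export Order.TTheory GRing.Theory Num.Theory.

Local Open Scope ring_scope.

Definition hmul (R : realType) (m n : nat) (A B : 'M[R]_(m, n)) : 'M[R]_(m, n) :=
  map2_mx (fun x y => x * y) A B.

(* An entry whose denominator is 0 has quotient 0, since [0^-1 = 0] here. *)
Definition hdiv (R : realType) (m n : nat) (A B : 'M[R]_(m, n)) : 'M[R]_(m, n) :=
  map2_mx (fun x y => x / y) A B.

Definition frobenius_norm (R : realType) (m n : nat) (A : 'M[R]_(m, n)) : R :=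
  Num.sqrt (\sum_(i < m) \sum_(j < n) A i j ^+ 2).

Definition l1_norm (R : realType) (m n : nat) (A : 'M[R]_(m, n)) : R :=
  \sum_(i < m) \sum_(j < n) `|A i j|.

Definition adj_nbr (N : nat) (nbr : 'I_N -> {set 'I_N}) (n : 'I_N) : {set 'I_N} :=
  [set l | n \in nbr l].

Definition grad_abs (R : realType) (N K : nat) (nbr : 'I_N -> {set 'I_N})
    (eps : R) (B : 'M[R]_(N, K)) (n : 'I_N) (k : 'I_K) : R :=
  Num.sqrt (eps ^+ 2 + \sum_(l in nbr n) (B n k - B l k) ^+ 2).

Definition TV (R : realType) (N K : nat) (nbr : 'I_N -> {set 'I_N})
    (eps : R) (B : 'M[R]_(N, K)) : R :=
  \sum_(k < K) \sum_(n < N) grad_abs nbr eps B n k.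

Definition matP (R : realType) (N K : nat) (nbr : 'I_N -> {set 'I_N})
    (eps : R) (B : 'M[R]_(N, K)) : 'M[R]_(N, K) :=
  \matrix_(n < N, k < K)
    ((grad_abs nbr eps B n k)^-1 * (\sum_(l in nbr n) 1)
     + \sum_(l in adj_nbr nbr n) (grad_abs nbr eps B l k)^-1).

(* If [nbr n] and [adj_nbr nbr n] are both empty, then row [n] of [matP] and
   of [matZ] is 0. *)
Definition matZ (R : realType) (N K : nat) (nbr : 'I_N -> {set 'I_N})
    (eps : R) (B : 'M[R]_(N, K)) : 'M[R]_(N, K) :=
  \matrix_(n < N, k < K)
    ((matP nbr eps B n k)^-1 *
     ((grad_abs nbr eps B n k)^-1 * (\sum_(l in nbr n) (B n k + B l k) / 2)
      + \sum_(l in adj_nbr nbr n)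
          (B n k + B l k) / (2 * grad_abs nbr eps B l k))).

Definition cost (R : realType) (M N T K : nat) (nbr : 'I_N -> {set 'I_N}) (eps : R)
    (A : 'M[R]_(M, N)) (Y : 'M[R]_(M, T)) (lamB muB lamC muC tau : R)
    (B : 'M[R]_(N, K)) (C : 'M[R]_(K, T)) : R :=
  2^-1 * frobenius_norm (A *m B *m C - Y) ^+ 2
  + lamC * l1_norm C + muC / 2 * frobenius_norm C ^+ 2
  + lamB * l1_norm B + muB / 2 * frobenius_norm B ^+ 2
  + tau / 2 * TV nbr eps B.

Definition updateB (R : realType) (M N T K : nat) (nbr : 'I_N -> {set 'I_N}) (eps : R)
    (A : 'M[R]_(M, N)) (Y : 'M[R]_(M, T)) (lamB muB tau : R)
    (B : 'M[R]_(N, K)) (C : 'M[R]_(K, T)) : 'M[R]_(N, K) :=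
  hmul B
    (hdiv (A^T *m Y *m C^T + tau *: hmul (matP nbr eps B) (matZ nbr eps B))
          (A^T *m A *m B *m C *m C^T + muB *: B + lamB *: const_mx 1
           + tau *: hmul B (matP nbr eps B))).

Definition updateC (R : realType) (M N T K : nat)
    (A : 'M[R]_(M, N)) (Y : 'M[R]_(M, T)) (lamC muC : R)
    (B : 'M[R]_(N, K)) (C : 'M[R]_(K, T)) : 'M[R]_(K, T) :=
  hmul C
    (hdiv (B^T *m A^T *m Y)
          (B^T *m A^T *m A *m B *m C + muC *: C + lamC *: const_mx 1)).

(* Main.v *)
(** Write the update as [X' = hmul X U]. Cauchy-Schwarz on the nonnegative
    products [L a i * X i j * Q j b] bounds the change of the data term by a
    separable quadratic in [U]; the bound [u <= (u ^+ 2 + 1) / 2] does the same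
    for the l1 norm, and concavity of the square root for the total variation.
    The sum of these majorants vanishes at [U = 1] and is minimal at
    [U = numerator / denominator], hence nonpositive there. Both blocks
    are instances of one such step: [(L, Q) = (A, C)] for [B], and
    [(L, Q) = (A *m B, 1%:M)] without additional penalty for [C]. Iterates may
    reach 0, so only nonnegativity is propagated; when a denominator vanishes
    at a positive entry, so does the numerator, and the majorant is constant in
    that entry. *)

From mathcomp Require Import ring lra.
Require Import Defs.

Set Implicit Arguments.
Unset Strict Implicit.
Unset Printing Implicit Defensive.

Local Open Scope ring_scope.

(** * Weighted Cauchy-Schwarz and sums over matrix entries *)

(** The gap is half the double sum of [w i * w j * (u i - u j) ^+ 2]. *)
Lemma sum_sqr_le (R : realType) (I : finType) (w u : I -> R) :
  (forall i, 0 <= w i) ->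
  (\sum_i w i * u i) ^+ 2 <= (\sum_i w i) * (\sum_i w i * u i ^+ 2).
Proof.
move=> w0; set s := \sum_i w i; set q := \sum_i w i * u i ^+ 2.
have -> : s * q = 2^-1 * (s * q) + 2^-1 * (q * s) by rewrite (mulrC q); lra.
rewrite expr2 !big_distrlr /= !mulr_sumr -big_split /=.
apply: ler_sum => i _; rewrite !mulr_sumr -big_split /=.
apply: ler_sum => j _.
have := mulr_ge0 (mulr_ge0 (w0 i) (w0 j)) (sqr_ge0 (u i - u j)).
by lra.
Qed.

Lemma mulmx3E (R : realType) (m n k t : nat) (L : 'M[R]_(m, n))
    (X : 'M[R]_(n, k)) (Q : 'M[R]_(k, t)) i j :
  (L *m X *m Q) i j = \sum_(p : 'I_n * 'I_k) L i p.1 * X p.1 p.2 * Q p.2 j.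
Proof.
rewrite -(pair_bigA _ (fun a b => L i a * X a b * Q b j)) /= exchange_big /=.
by rewrite mxE; apply: eq_bigr => b _; rewrite mxE mulr_suml.
Qed.

Lemma sum_entries_trace (R : realType) (m n : nat) (X Y : 'M[R]_(m, n)) :
  \sum_(p : 'I_m * 'I_n) X p.1 p.2 * Y p.1 p.2 = \tr (X^T *m Y).
Proof.
rewrite -(pair_bigA _ (fun i j => X i j * Y i j)) /= exchange_big /=.
apply: eq_bigr => j _; rewrite mxE.
by apply: eq_bigr => i _; rewrite mxE.
Qed.

(** Cyclicity of the trace. It carries sums over the entries of the data over to sums over the
    entries of the block, where the majorant is separable. *)
Lemma mulmx3_adjoint (R : realType) (m n k t : nat) (L : 'M[R]_(m, n))
    (V : 'M[R]_(n, k)) (Q : 'M[R]_(k, t)) (S : 'M[R]_(m, t)) :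
  \sum_(p : 'I_m * 'I_t) S p.1 p.2 * (L *m V *m Q) p.1 p.2 =
  \sum_(p : 'I_n * 'I_k) (L^T *m S *m Q^T) p.1 p.2 * V p.1 p.2.
Proof.
rewrite !sum_entries_trace !trmx_mul !trmxK mulmxA mxtrace_mulC.
by rewrite !mulmxA.
Qed.

Lemma mulmx_ge0 (R : realType) (m n p : nat) (X : 'M[R]_(m, n))
    (Y : 'M[R]_(n, p)) :
  (forall i j, 0 <= X i j) -> (forall i j, 0 <= Y i j) ->
  forall i j, 0 <= (X *m Y) i j.
Proof. by move=> X0 Y0 i j; rewrite mxE sumr_ge0 // => l _; rewrite mulr_ge0. Qed.

Lemma trmx_ge0 (R : realType) (m n : nat) (X : 'M[R]_(m, n)) :
  (forall i j, 0 <= X i j) -> forall i j, 0 <= X^T i j.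
Proof. by move=> X0 i j; rewrite mxE. Qed.

Lemma frobenius_norm_sqr (R : realType) (m n : nat) (X : 'M[R]_(m, n)) :
  frobenius_norm X ^+ 2 = \sum_(p : 'I_m * 'I_n) X p.1 p.2 ^+ 2.
Proof.
rewrite /frobenius_norm pair_bigA sqr_sqrtr //.
by rewrite sumr_ge0 // => p _; rewrite sqr_ge0.
Qed.

Lemma l1_norm_ge0E (R : realType) (m n : nat) (X : 'M[R]_(m, n)) :
  (forall i j, 0 <= X i j) ->
  l1_norm X = \sum_(p : 'I_m * 'I_n) X p.1 p.2.
Proof.
move=> X0; rewrite /l1_norm pair_bigA /=.
by apply: eq_bigr => p _; rewrite ger0_norm.
Qed.

(** * Separable majorant of the data term *)

Lemma data_term_majorization (R : realType) (m n k t : nat) (L : 'M[R]_(m, n))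
    (Q : 'M[R]_(k, t)) (Y : 'M[R]_(m, t)) (X U : 'M[R]_(n, k)) :
  (forall i j, 0 <= L i j) -> (forall i j, 0 <= Q i j) ->
  (forall i j, 0 <= X i j) ->
  frobenius_norm (L *m hmul X U *m Q - Y) ^+ 2
    - frobenius_norm (L *m X *m Q - Y) ^+ 2
  <= \sum_(p : 'I_n * 'I_k) X p.1 p.2 *
       ((L^T *m L *m X *m Q *m Q^T) p.1 p.2 * (U p.1 p.2 ^+ 2 - 1)
        - 2 * (L^T *m Y *m Q^T) p.1 p.2 * (U p.1 p.2 - 1)).
Proof.
move=> L0 Q0 X0; set S := L *m X *m Q.
set V1 := hmul X U - X; set V2 := hmul X (hmul U U) - X.
have -> : L^T *m L *m X *m Q *m Q^T = L^T *m S *m Q^T by rewrite !mulmxA.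
have -> : \sum_(p : 'I_n * 'I_k) X p.1 p.2 *
       ((L^T *m S *m Q^T) p.1 p.2 * (U p.1 p.2 ^+ 2 - 1)
        - 2 * (L^T *m Y *m Q^T) p.1 p.2 * (U p.1 p.2 - 1)) =
    \sum_(p : 'I_n * 'I_k) (L^T *m S *m Q^T) p.1 p.2 * V2 p.1 p.2
    - 2 * \sum_(p : 'I_n * 'I_k) (L^T *m Y *m Q^T) p.1 p.2 * V1 p.1 p.2.
  rewrite mulr_sumr -sumrB; apply: eq_bigr => p _.
  by rewrite [V1]lock [V2]lock -!lock !mxE; ring.
rewrite -!mulmx3_adjoint !frobenius_norm_sqr mulr_sumr -!sumrB.
apply: ler_sum => -[i j] _ /=.
(* The terms linear in [Y] agree on both sides of the goal, so only this bound on the square is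
   left. It is Cauchy-Schwarz with weights [w], whose sum is [S i j]. *)
have CS : (L *m hmul X U *m Q) i j ^+ 2
    <= S i j * (L *m hmul X (hmul U U) *m Q) i j.
  rewrite !mulmx3E.
  pose w (p : 'I_n * 'I_k) := L i p.1 * X p.1 p.2 * Q p.2 j.
  have w0 p : 0 <= w p by rewrite !mulr_ge0.
  have := sum_sqr_le (fun p => U p.1 p.2) w0.
  suff: \sum_p w p * U p.1 p.2
          = \sum_p L i p.1 * hmul X U p.1 p.2 * Q p.2 j /\
        \sum_p w p * U p.1 p.2 ^+ 2
          = \sum_p L i p.1 * hmul X (hmul U U) p.1 p.2 * Q p.2 j.
    by case=> -> ->.
  by split; apply: eq_bigr => p _; rewrite /w !mxE; ring.
rewrite /V1 /V2 !mulmxBr !mulmxBl -/S.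
set a := L *m hmul X U *m Q in CS *; set b := L *m _ *m Q in CS *.
have E (P P' : 'M[R]_(m, t)) : (P - P') i j = P i j - P' i j by rewrite !mxE.
by rewrite !E; nra.
Qed.

(** * One multiplicative step on a single block *)

Definition block_cost (R : realType) (m n k t : nat) (L : 'M[R]_(m, n))
    (Q : 'M[R]_(k, t)) (Y : 'M[R]_(m, t)) (lam mu : R) (r : 'M[R]_(n, k) -> R)
    (X : 'M[R]_(n, k)) : R :=
  2^-1 * frobenius_norm (L *m X *m Q - Y) ^+ 2 + lam * l1_norm X
  + mu / 2 * frobenius_norm X ^+ 2 + r X.

(* The weights [P], [W] stand for a separable quadratic majorant at [X] of the
   additional penalty, with [i, j] part [P i j / 2 * x ^+ 2 - W i j * x]. *)
Definition mult_update (R : realType) (m n k t : nat) (L : 'M[R]_(m, n))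
    (Q : 'M[R]_(k, t)) (Y : 'M[R]_(m, t)) (lam mu : R) (P W X : 'M[R]_(n, k)) :=
  hmul X (hdiv (L^T *m Y *m Q^T + W)
    (L^T *m L *m X *m Q *m Q^T + mu *: X + lam *: const_mx 1 + hmul X P)).

Lemma mult_update_ge0 (R : realType) (m n k t : nat) (L : 'M[R]_(m, n))
    (Q : 'M[R]_(k, t)) (Y : 'M[R]_(m, t)) (lam mu : R) (P W X : 'M[R]_(n, k)) :
  (forall i j, 0 <= L i j) -> (forall i j, 0 <= Q i j) ->
  (forall i j, 0 <= Y i j) -> 0 <= lam -> 0 <= mu ->
  (forall i j, 0 <= P i j) -> (forall i j, 0 <= W i j) ->
  (forall i j, 0 <= X i j) ->
  forall i j, 0 <= mult_update L Q Y lam mu P W X i j.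
Proof.
move=> L0 Q0 Y0 lam0 mu0 P0 W0 X0 i j.
have LT0 := trmx_ge0 L0; have QT0 := trmx_ge0 Q0.
have n0 := mulmx_ge0 (mulmx_ge0 LT0 Y0) QT0 i j.
have d0 := mulmx_ge0 (mulmx_ge0 (mulmx_ge0 (mulmx_ge0 LT0 L0) X0) Q0) QT0 i j.
rewrite /mult_update; move: n0 d0.
set a := _ *m Q^T; set b := _ *m Q^T => n0 d0.
clearbody a b; rewrite !mxE.
by rewrite mulr_ge0 ?divr_ge0 ?addr_ge0 // ?mulr_ge0.
Qed.

(* A vanishing quadratic coefficient at a positive entry [X i j] forces
   [L a i * Q j b = 0] for all [a], [b]. *)
Lemma data_linear_coeff_eq0 (R : realType) (m n k t : nat) (L : 'M[R]_(m, n))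
    (Q : 'M[R]_(k, t)) (Y : 'M[R]_(m, t)) (X : 'M[R]_(n, k)) i j :
  (forall i j, 0 <= L i j) -> (forall i j, 0 <= Q i j) ->
  (forall i j, 0 <= X i j) -> 0 < X i j ->
  (L^T *m L *m X *m Q *m Q^T) i j = 0 -> (L^T *m Y *m Q^T) i j = 0.
Proof.
move=> L0 Q0 X0 Xij.
have -> : L^T *m L *m X *m Q *m Q^T = L^T *m (L *m X *m Q) *m Q^T.
  by rewrite !mulmxA.
have S0 := mulmx_ge0 (mulmx_ge0 L0 X0) Q0.
rewrite !mulmx3E => /psumr_eq0P z.
apply: big1 => -[a b] _ /=.
have /eqP := z (fun p _ => mulr_ge0 (mulr_ge0 (trmx_ge0 L0 _ _) (S0 _ _))
                             (trmx_ge0 Q0 _ _)) (a, b) isT.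
rewrite /= !mulf_eq0.
case/orP=> [/orP[]|] /eqP e; rewrite ?e ?mul0r ?mulr0 //.
have := e; rewrite mulmx3E => /psumr_eq0P z'.
have /eqP := z' (fun p _ => mulr_ge0 (mulr_ge0 (L0 _ _) (X0 _ _)) (Q0 _ _)) (i, j) isT.
rewrite /= !mulf_eq0 (gt_eqF Xij) orbF.
by rewrite !mxE; case/orP=> /eqP ->; rewrite ?mul0r ?mulr0.
Qed.

(** At an entry [x] with denominator [den] and factor [u], the bound on the change of the cost
    equals [- x / 2 * (den + lam) * (1 - u) ^+ 2]. The implication from [P i j = 0] to [W i j = 0]
    makes the numerator vanish along with the denominator. *)
Lemma mult_update_decrease (R : realType) (m n k t : nat) (L : 'M[R]_(m, n))
    (Q : 'M[R]_(k, t)) (Y : 'M[R]_(m, t)) (lam mu : R) (P W X : 'M[R]_(n, k))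
    (r : 'M[R]_(n, k) -> R) :
  (forall i j, 0 <= L i j) -> (forall i j, 0 <= Q i j) ->
  (forall i j, 0 <= Y i j) -> 0 <= lam -> 0 <= mu ->
  (forall i j, 0 <= P i j) -> (forall i j, 0 <= W i j) ->
  (forall i j, P i j = 0 -> W i j = 0) ->
  (forall i j, 0 <= X i j) ->
  (forall X', r X' - r X <= \sum_(p : 'I_n * 'I_k)
      (2^-1 * P p.1 p.2 * (X' p.1 p.2 ^+ 2 - X p.1 p.2 ^+ 2)
       - W p.1 p.2 * (X' p.1 p.2 - X p.1 p.2))) ->
  block_cost L Q Y lam mu r (mult_update L Q Y lam mu P W X)
  <= block_cost L Q Y lam mu r X.
Proof.
move=> L0 Q0 Y0 lam0 mu0 P0 W0 PW X0 rX; rewrite /block_cost -subr_le0.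
(* Nonnegativity of the new block removes the absolute values from its l1 norm. *)
have X'0 := mult_update_ge0 L0 Q0 Y0 lam0 mu0 P0 W0 X0.
rewrite (l1_norm_ge0E X'0) (l1_norm_ge0E X0) 2!(frobenius_norm_sqr (_ : 'M_(n, k))).
have LT0 := trmx_ge0 L0; have QT0 := trmx_ge0 Q0.
have d0 := mulmx_ge0 (mulmx_ge0 (mulmx_ge0 (mulmx_ge0 LT0 L0) X0) Q0) QT0.
have dn0 i j := @data_linear_coeff_eq0 _ _ _ _ _ L Q Y X i j L0 Q0 X0.
move: (rX (mult_update L Q Y lam mu P W X)); rewrite /mult_update.
set U := hdiv _ _; have := data_term_majorization Y U L0 Q0 X0.
set F1 := frobenius_norm _ ^+ 2; set F0 := frobenius_norm _ ^+ 2.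
set r1 := r _; set r0 := r _ => hF hr.
rewrite -/U.
set s1 := \sum_p _ in hF; set s2 := \sum_p _ in hr.
set a1 := \sum_p _; set a0 := \sum_p X _ _; set b1 := \sum_p _; set b0 := \sum_p _.
have : 2^-1 * s1 + lam * (a1 - a0) + mu / 2 * (b1 - b0) + s2 <= 0; last by lra.
rewrite /s1 /s2 /a1 /a0 /b1 /b0 -!sumrB !mulr_sumr -!big_split /=.
apply: sumr_le0 => -[i j] _ /=.
have HU : hmul X U i j = X i j * U i j by rewrite mxE.
rewrite HU.
have [Xij|Xij] := eqVneq (X i j) 0.
  by rewrite Xij !(mul0r, mulr0, subrr, addr0).
have Xgt : 0 < X i j by rewrite lt_neqAle eq_sym Xij X0.
have := d0 i j; have := dn0 i j Xgt.
have UE : U i j = ((L^T *m Y *m Q^T) i j + W i j) /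
   ((L^T *m L *m X *m Q *m Q^T) i j + mu * X i j + lam + X i j * P i j).
  rewrite /U; set a := _ *m Q^T; set b := _ *m Q^T.
  by clearbody a b; rewrite !mxE mulr1.
move: UE; set h := (L^T *m L *m X *m Q *m Q^T) i j.
set y := (L^T *m Y *m Q^T) i j; set u := U i j; set x := X i j in Xgt *.
set den := (_ + x * P i j) => UE hy h0.
have m0 : 0 <= mu * x by rewrite mulr_ge0 // ltW.
have p0 : 0 <= x * P i j by rewrite mulr_ge0 // ltW.
(* Stationarity of the majorant in [u], in a form that survives [den = 0]: the nonnegative summands
   of [den] then all vanish, hence so do [y] and [W i j]. *)
have eq : den * u = y + W i j.
  rewrite UE; have [den0|den0] := eqVneq den 0; last by rewrite mulrC divfK.
  have hh : h = 0 by rewrite /den in den0; lra.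
  have xP : x * P i j = 0 by rewrite /den in den0; lra.
  have /PW -> : P i j = 0.
    by apply/eqP; move/eqP: xP; rewrite mulf_eq0 (gt_eqF Xgt).
  by rewrite (hy hh) add0r mul0r mulr0.
have den_ge0 : 0 <= den.
  by rewrite /den !addr_ge0.
have G : x * (den * (1 - u) ^+ 2) >= 0.
  exact: mulr_ge0 (ltW Xgt) (mulr_ge0 den_ge0 (sqr_ge0 _)).
(* The l1 term has been kept linear; this square is twice the gap to its quadratic bound. *)
have Hl : 0 <= lam * x * (1 - u) ^+ 2.
  exact: mulr_ge0 (mulr_ge0 lam0 (ltW Xgt)) (sqr_ge0 _).
have yE : y = den * u - W i j by rewrite eq addrK.
rewrite yE /den in G *; clear -G Hl; lra.
Qed.

(** * Separable majorant of the total variation *)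

Lemma grad_abs_gt0 (R : realType) (N K : nat) (nbr : 'I_N -> {set 'I_N})
    (eps : R) (B : 'M[R]_(N, K)) n k :
  0 < eps -> 0 < grad_abs nbr eps B n k.
Proof.
move=> e0; rewrite sqrtr_gt0 ltr_wpDr ?exprn_gt0 //.
by rewrite sumr_ge0 // => l _; rewrite sqr_ge0.
Qed.

(** With [s] and [r] the roots of [a] and [b], the gap is [(r - s) ^+ 2 / (2 * s)]. *)
Lemma sqrtr_tangent (R : realType) (a b : R) : 0 < a -> 0 <= b ->
  Num.sqrt b - Num.sqrt a <= (Num.sqrt a)^-1 * ((b - a) / 2).
Proof.
move=> a0 b0; set s := Num.sqrt a; set r := Num.sqrt b.
have s0 : 0 < s by rewrite sqrtr_gt0.
have -> : b - a = r ^+ 2 - s ^+ 2 by rewrite !sqr_sqrtr // ltW.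
rewrite -subr_ge0.
have -> : s^-1 * ((r ^+ 2 - s ^+ 2) / 2) - (r - s) = s^-1 * ((r - s) ^+ 2 / 2).
  by field; rewrite gt_eqF.
by rewrite mulr_ge0 ?divr_ge0 ?sqr_ge0 // invr_ge0 ltW.
Qed.

Lemma sum_adj_nbr (R : realType) (N : nat) (nbr : 'I_N -> {set 'I_N})
    (f : 'I_N -> 'I_N -> R) :
  \sum_n \sum_(l in nbr n) f n l = \sum_n \sum_(l in adj_nbr nbr n) f l n.
Proof.
rewrite (exchange_big_dep predT) //=.
by apply: eq_bigr => n _; apply: eq_bigl => l; rewrite inE.
Qed.

Lemma matP_ge0 (R : realType) (N K : nat) (nbr : 'I_N -> {set 'I_N})
    (eps : R) (B : 'M[R]_(N, K)) n k : 0 < eps -> 0 <= matP nbr eps B n k.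
Proof.
move=> e0; rewrite mxE addr_ge0 ?mulr_ge0 ?sumr_ge0 // => *;
  by rewrite invr_ge0 ltW // grad_abs_gt0.
Qed.

(* Holds also at the junk value [matZ = 0]: if [matP] vanishes, then both
   neighbourhoods are empty. *)
Lemma matPZE (R : realType) (N K : nat) (nbr : 'I_N -> {set 'I_N})
    (eps : R) (B : 'M[R]_(N, K)) n k : 0 < eps ->
  matP nbr eps B n k * matZ nbr eps B n k =
  \sum_(l in nbr n) (grad_abs nbr eps B n k)^-1 * ((B n k + B l k) / 2)
  + \sum_(l in adj_nbr nbr n) (grad_abs nbr eps B l k)^-1 * ((B n k + B l k) / 2).
Proof.
move=> e0; rewrite [matZ _ _ _ _ _]mxE.
have -> : \sum_(l in adj_nbr nbr n) (B n k + B l k) / (2 * grad_abs nbr eps B l k)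
  = \sum_(l in adj_nbr nbr n) (grad_abs nbr eps B l k)^-1 * ((B n k + B l k) / 2).
  by apply: eq_bigr => l _; rewrite invfM; ring.
rewrite mulr_sumr.
have [P0|P0] := eqVneq (matP nbr eps B n k) 0; last by rewrite mulrA mulfV ?mul1r.
rewrite P0 mul0r; move: P0; rewrite mxE => /eqP.
have g0 l : 0 < (grad_abs nbr eps B l k)^-1 by rewrite invr_gt0 grad_abs_gt0.
rewrite paddr_eq0 ?mulr_ge0 ?sumr_ge0 ?(ltW (g0 _)) // => [/andP[]|l _]; last first.
  exact: ltW.
rewrite mulf_eq0 (gt_eqF (g0 n)) /= => /eqP/psumr_eq0P z1 /eqP/psumr_eq0P z2.
rewrite !big1 ?addr0 // => l ln.
  by have /eqP := z2 (fun l _ => ltW (g0 l)) l ln; rewrite gt_eqF.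
by have /eqP := z1 (fun _ _ => ler01) l ln; rewrite oner_eq0.
Qed.

(** The tangent bound at [B] leaves weighted squared differences over neighbouring pairs. Each is
    split into a part for either pixel; collecting the parts of one pixel over both neighbourhoods
    yields [matP] and its product with [matZ]. *)
Lemma TV_majorization (R : realType) (N K : nat) (nbr : 'I_N -> {set 'I_N})
    (eps : R) (B X : 'M[R]_(N, K)) : 0 < eps ->
  TV nbr eps X - TV nbr eps B <=
  \sum_(p : 'I_N * 'I_K)
    (matP nbr eps B p.1 p.2 * (X p.1 p.2 ^+ 2 - B p.1 p.2 ^+ 2)
     - 2 * (matP nbr eps B p.1 p.2 * matZ nbr eps B p.1 p.2)
         * (X p.1 p.2 - B p.1 p.2)).
Proof.
move=> e0.
rewrite -(pair_bigA _ (fun n k => matP nbr eps B n k * (X n k ^+ 2 - B n k ^+ 2)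
     - 2 * (matP nbr eps B n k * matZ nbr eps B n k) * (X n k - B n k))) /=.
rewrite exchange_big /TV -sumrB; apply: ler_sum => k _ /=.
pose g n := (grad_abs nbr eps B n k)^-1.
pose a n l := (B n k + B l k) / 2.
(* The share of pixel [n] in the pair: [(X n k - a n l) ^+ 2 - (B n k - a n l) ^+ 2]. *)
pose h n l := (X n k ^+ 2 - B n k ^+ 2) - 2 * a n l * (X n k - B n k).
have -> : \sum_n (matP nbr eps B n k * (X n k ^+ 2 - B n k ^+ 2)
     - 2 * (matP nbr eps B n k * matZ nbr eps B n k) * (X n k - B n k))
  = \sum_n \sum_(l in nbr n) g n * (h n l + h l n).
  under [RHS]eq_bigr do under eq_bigr do rewrite mulrDr.
  under [RHS]eq_bigr do rewrite big_split.
  (* The shares of the neighbours [l] are credited to the pixel they belong to, which is where the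
     adjoint neighbourhood enters. *)
  have adjE : \sum_n \sum_(l in nbr n) g n * h l n
    = \sum_n \sum_(l in adj_nbr nbr n) g l * h n l.
    exact: (sum_adj_nbr nbr (fun n l => g n * h l n)).
  rewrite [RHS]big_split /= adjE -[RHS]big_split /=.
  apply: eq_bigr => n _; rewrite matPZE // mxE.
  set D := X n k ^+ 2 - _; set E := X n k - _.
  rewrite (mulrDl _ _ D) (mulrDr 2) (mulrDl _ _ E) opprD addrACA.
  by congr (_ + _); rewrite !(mulr_sumr, mulr_suml) -sumrB;
    apply: eq_bigr => l _; rewrite /h /g /a -/D -/E; ring.
rewrite -sumrB; apply: ler_sum => n _.
have sq0 (Z : 'M[R]_(N, K)) : 0 <= \sum_(l in nbr n) (Z n k - Z l k) ^+ 2.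
  by rewrite sumr_ge0 // => l _; rewrite sqr_ge0.
have ee : 0 < eps ^+ 2 by rewrite exprn_gt0.
have gsq (Z : 'M[R]_(N, K)) : 0 < eps ^+ 2 + \sum_(l in nbr n) (Z n k - Z l k) ^+ 2.
  exact: ltr_wpDr.
apply: (le_trans (sqrtr_tangent (gsq B) (ltW (gsq X)))).
rewrite -[leRHS]mulr_sumr -/(grad_abs nbr eps B n k) ler_pM2l ?invr_gt0 ?grad_abs_gt0 //.
rewrite opprD addrACA subrr add0r -sumrB mulr_suml; apply: ler_sum => l _.
(* With [a] the mean of [B n k] and [B l k], [(x - y)^2 <= 2 (x - a)^2 + 2 (y - a)^2]
   separates [x = X n k] from [y = X l k] and is an equality at [X = B]. *)
by rewrite -subr_ge0 /h /a; have := sqr_ge0 (X n k + X l k - B n k - B l k); lra.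
Qed.

(** * The two updates as block steps, and the alternating descent *)

Lemma updateB_mult_update (R : realType) (M N T K : nat)
    (nbr : 'I_N -> {set 'I_N}) (eps : R) (A : 'M[R]_(M, N)) (Y : 'M[R]_(M, T))
    (lamB muB tau : R) (B : 'M[R]_(N, K)) (C : 'M[R]_(K, T)) :
  updateB nbr eps A Y lamB muB tau B C =
  mult_update A C Y lamB muB (tau *: matP nbr eps B)
    (tau *: hmul (matP nbr eps B) (matZ nbr eps B)) B.
Proof.
rewrite /updateB /mult_update; congr (hmul B (hdiv _ (_ + _))).
by apply/matrixP => n k; rewrite [LHS]mxE [in LHS]mxE [RHS]mxE [in RHS]mxE mulrCA.
Qed.

Lemma updateC_mult_update (R : realType) (M N T K : nat) (A : 'M[R]_(M, N))
    (Y : 'M[R]_(M, T)) (lamC muC : R) (B : 'M[R]_(N, K)) (C : 'M[R]_(K, T)) :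
  updateC A Y lamC muC B C = mult_update (A *m B) 1%:M Y lamC muC 0 0 C.
Proof.
rewrite /updateC /mult_update trmx1 !mulmx1 trmx_mul !mulmxA addr0.
have -> : hmul C 0 = 0 by apply/matrixP => k t; rewrite !mxE mulr0.
by rewrite addr0.
Qed.

Theorem corollary2p1 (R : realType) (M N T K : nat)
    (M_gt0 : (0 < M)%N) (N_gt0 : (0 < N)%N) (T_gt0 : (0 < T)%N) (K_gt0 : (0 < K)%N)
    (nbr : 'I_N -> {set 'I_N}) (eps : R) (eps_gt0 : 0 < eps)
    (A : 'M[R]_(M, N)) (Y : 'M[R]_(M, T))
    (A_ge0 : forall i j, 0 <= A i j) (Y_ge0 : forall i j, 0 <= Y i j)
    (lamB muB lamC muC tau : R)
    (lamB_ge0 : 0 <= lamB) (muB_ge0 : 0 <= muB)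
    (lamC_ge0 : 0 <= lamC) (muC_ge0 : 0 <= muC) (tau_ge0 : 0 <= tau)
    (B : nat -> 'M[R]_(N, K)) (C : nat -> 'M[R]_(K, T))
    (B0_gt0 : forall n k, 0 < B 0%N n k) (C0_gt0 : forall k t, 0 < C 0%N k t)
    (B_step : forall d : nat,
        B d.+1 = updateB nbr eps A Y lamB muB tau (B d) (C d))
    (C_step : forall d : nat,
        C d.+1 = updateC A Y lamC muC (B d.+1) (C d)) :
  forall d : nat,
    cost nbr eps A Y lamB muB lamC muC tau (B d.+1) (C d.+1)
    <= cost nbr eps A Y lamB muB lamC muC tau (B d) (C d).
Proof.
have P_ge0 (X : 'M[R]_(N, K)) n k : 0 <= (tau *: matP nbr eps X) n k.
  by rewrite mxE mulr_ge0 ?matP_ge0.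
have PZ_ge0 (X : 'M[R]_(N, K)) (X_ge0 : forall n k, 0 <= X n k) n k :
    0 <= (tau *: hmul (matP nbr eps X) (matZ nbr eps X)) n k.
  rewrite mxE mulr_ge0 // mxE matPZE //.
  by rewrite addr_ge0 ?sumr_ge0 // => l _;
    rewrite mulr_ge0 ?divr_ge0 ?addr_ge0 // invr_ge0 ltW // grad_abs_gt0.
have PZ_eq0 (X : 'M[R]_(N, K)) n k : (tau *: matP nbr eps X) n k = 0 ->
    (tau *: hmul (matP nbr eps X) (matZ nbr eps X)) n k = 0.
  rewrite mxE => /eqP; rewrite mulf_eq0 => /orP[]/eqP z; rewrite [LHS]mxE ?z ?mul0r //.
  by rewrite [X in _ * X]mxE z mul0r mulr0.
have one_ge0 (i j : 'I_T) : 0 <= (1%:M : 'M[R]_T) i j by rewrite mxE ler0n.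
have zero_ge0 (i : 'I_K) (j : 'I_T) : 0 <= (0 : 'M[R]_(K, T)) i j by rewrite mxE.
have BC_ge0 d : (forall n k, 0 <= B d n k) /\ (forall k t, 0 <= C d k t).
  elim: d => [|d [Bd_ge0 Cd_ge0]]; first by split=> *; apply: ltW.
  have BS_ge0 n k : 0 <= B d.+1 n k.
    rewrite B_step updateB_mult_update; apply: mult_update_ge0 => //.
    exact: PZ_ge0.
  split=> // k t; rewrite C_step updateC_mult_update.
  by apply: mult_update_ge0 => //; apply: mulmx_ge0.
move=> d; have [Bd_ge0 Cd_ge0] := BC_ge0 d.
have [BS_ge0 _] := BC_ge0 d.+1.
(* The intermediate state has only [B] updated; the [C] step is treated first, then the [B] step. *)
apply: (@le_trans _ _ (cost nbr eps A Y lamB muB lamC muC tau (B d.+1) (C d))).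
  have := @mult_update_decrease _ _ _ _ _ (A *m B d.+1) 1%:M Y lamC muC 0 0 (C d)
    (fun=> 0) (mulmx_ge0 A_ge0 BS_ge0) one_ge0 Y_ge0 lamC_ge0 muC_ge0
    zero_ge0 zero_ge0 (fun _ _ => id) Cd_ge0.
  rewrite -updateC_mult_update -C_step /block_cost /cost !mulmx1.
  move=> decC; lapply decC; [by lra | clear decC].
  by move=> X'; rewrite subrr big1 // => p _; rewrite !mxE mulr0 !mul0r subrr.
have := @mult_update_decrease _ _ _ _ _ A (C d) Y lamB muB (tau *: matP nbr eps (B d))
  (tau *: hmul (matP nbr eps (B d)) (matZ nbr eps (B d))) (B d)
  (fun X => tau / 2 * TV nbr eps X) A_ge0 Cd_ge0 Y_ge0 lamB_ge0 muB_ge0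
  (P_ge0 _) (PZ_ge0 _ Bd_ge0) (PZ_eq0 _) Bd_ge0.
rewrite -updateB_mult_update -B_step /block_cost /cost.
(* The factor [tau / 2] of the penalty turns the weights of [TV_majorization] into halved
   [tau *: matP] for the squares and [tau *: hmul matP matZ] for the linear part. *)
suff TVd X' : tau / 2 * TV nbr eps X' - tau / 2 * TV nbr eps (B d) <=
    \sum_(p : 'I_N * 'I_K)
      (2^-1 * (tau *: matP nbr eps (B d)) p.1 p.2 * (X' p.1 p.2 ^+ 2 - B d p.1 p.2 ^+ 2)
       - (tau *: hmul (matP nbr eps (B d)) (matZ nbr eps (B d))) p.1 p.2
           * (X' p.1 p.2 - B d p.1 p.2)).
  by move=> /(_ TVd); lra.
have tau2 : 0 <= tau / 2 by rewrite divr_ge0.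
rewrite -mulrBr; apply: le_trans (ler_wpM2l tau2 (TV_majorization nbr (B d) X' eps_gt0)) _.
rewrite mulr_sumr; apply: ler_sum => p _.
set P := matP _ _ _; set Z := matZ _ _ _; clearbody P Z.
by rewrite !mxE le_eqVlt; apply/orP; left; apply/eqP; field.
Qed.
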